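(* Let $q\ge 2$. For all integers $m,n\ge 1$, the number $B_m^{(-n)}(q)$ of $q$-ary strong lonesum $m\times n$ matrices equals $$1+\sum_{j=1}^{\min(m,n)}\ \sum_{\substack{(m_0,\ldots,m_j)\in\mathcal{S}_m^j\\ (n_0,\ldots,n_j)\in\mathcal{S}_n^j}}\binom{m}{m_0,m_1,\ldots,m_j}\binom{n}{n_0,n_1,\ldots,n_j}\prod_{i=1}^{j}f_q(m_i,n_{j+1-i}),$$ where $$f_q(r,s)=1+(q-2)rs+r\big((q-1)^s-(q-2)s-1\big)+s\big((q-1)^r-(q-2)r-1\big).$$
   Context: A $q$-ary matrix has entries in $\{0,1,\ldots,q-1\}$; a $q$-ary $m\times n$ matrix is a strong lonesum matrix if no other $q$-ary $m\times n$ matrix has the same row sums and column sums. For $j\ge 1$ and $l\ge 1$, $\mathcal{S}_l^j=\{(l_0,l_1,\ldots,l_j)\in\mathbb{Z}^{j+1}: \sum_{i=0}^j l_i=l,\ l_0\ge 0,\ l_i\ge 1 \text{ for } 1\le i\le j\}$. $\binom{l}{l_0,\ldots,l_j}=\frac{l!}{l_0!\cdots l_j!}$ is the multinomial coefficient. *)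

(* Defs.v *)
From HB Require Import structures.
From mathcomp Require Import all_boot all_order all_algebra.
Set Implicit Arguments. Unset Strict Implicit. Unset Printing Implicit Defensive.
Import Order.TTheory GRing.Theory Num.Theory.

Definition row_sums q m n (A : 'M['I_q]_(m, n)) : 'I_m -> nat :=
  fun i => (\sum_(j < n) nat_of_ord (A i j))%N.
Definition col_sums q m n (A : 'M['I_q]_(m, n)) : 'I_n -> nat :=
  fun j => (\sum_(i < m) nat_of_ord (A i j))%N.

Definition strong_lonesum q m n (A : 'M['I_q]_(m, n)) : Prop :=
  forall B : 'M['I_q]_(m, n),
    row_sums B =1 row_sums A -> col_sums B =1 col_sums A -> B = A.

Definition strong_lonesumb q m n (A : 'M['I_q]_(m, n)) : bool :=
  [forall B : 'M['I_q]_(m, n),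
    ([forall i, row_sums B i == row_sums A i] &&
     [forall j, col_sums B j == col_sums A j]) ==> (B == A)].

Definition num_strong_lonesum q m n : nat :=
  #|[set A : 'M['I_q]_(m, n) | strong_lonesumb A]|.

(* S_l^j : tuples (l_0,...,l_j) of nats (each entry <= l, automatically) with
   sum l, l_0 >= 0, l_i >= 1 for 1 <= i <= j. Encoded as finite functions
   'I_j.+1 -> 'I_l.+1. *)
Definition S_set (l j : nat) : {set {ffun 'I_j.+1 -> 'I_l.+1}} :=
  [set t : {ffun 'I_j.+1 -> 'I_l.+1} | ((\sum_(i < j.+1) nat_of_ord (t i))%N == l)
           && [forall i : 'I_j.+1, (i != ord0) ==> (0 < t i)%N]].

Definition multinom (l j : nat) (t : 'I_j.+1 -> nat) : nat :=
  (l`! %/ \prod_(i < j.+1) (t i)`!)%N.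

Local Open Scope ring_scope.
Definition fq (q r s : nat) : int :=
  1 + (q%:Z - 2) * (r * s)%:Z
    + (r%:Z : int) * ((q%:Z - 1) ^+ s - (q%:Z - 2) * s%:Z - 1)
    + (s%:Z : int) * ((q%:Z - 1) ^+ r - (q%:Z - 2) * r%:Z - 1).

(* Main.v *)
(** A matrix is strong lonesum iff it admits no switch, i.e. no 2 x 2 minor in
which a unit can be moved from the antidiagonal to the diagonal.  In a
switch-free matrix the supports of the rows form a chain; ranking the rows and
the columns along this chain gives labels [r x] and [d y] in [0..j] such that an
entry is nonzero iff [0 < r x <= d y], is [q - 1] when [0 < r x < d y], and on
each corner block [r x = d y = i > 0] the entries other than [q - 1] all lie on
one row or on one column.  Conversely, such a staircase matrix maximizes a
weighted sum of entries that only depends on the row and column sums, which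
makes it strong lonesum.  The labels are determined by the matrix, the corner
blocks can be filled independently, and an [s x t] corner block can be filled in
[f_q(s, t)] ways; grouping the labelings by fiber sizes yields the multinomial
coefficients.  The column labels here are those of the theorem up to the
involution [k |-> - k] of Z/(j+1). *)
Require Import Defs.
From HB Require Import structures.
From mathcomp Require Import all_boot all_order all_algebra.
From mathcomp Require Import zify ring.
Set Implicit Arguments. Unset Strict Implicit. Unset Printing Implicit Defensive.
Import Order.TTheory GRing.Theory Num.Theory.

(** * Labelings with prescribed fiber sizes *)

Definition cons_ffun (I : finType) m (p : I * {ffun 'I_m -> I}) : {ffun 'I_m.+1 -> I} :=
  [ffun x => if unlift ord0 x is Some y then p.2 y else p.1].

Lemma cons_ffun_bij (I : finType) m : bijective (@cons_ffun I m).
Proof.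
exists (fun r : {ffun 'I_m.+1 -> I} => (r ord0, [ffun y => r (lift ord0 y)])).
  move=> [i r]; rewrite /cons_ffun /= ffunE unlift_none; congr (_, _).
  by apply/ffunP=> y; rewrite !ffunE liftK.
move=> r; apply/ffunP=> x; rewrite ffunE /=.
by case: unliftP => [y|] ->; rewrite ?ffunE.
Qed.

Lemma card_fiber_cons_ffun (I : finType) m (p : I * {ffun 'I_m -> I}) k :
  #|[set x | cons_ffun p x == k]| = (p.1 == k) + #|[set y | p.2 y == k]|.
Proof.
rewrite -!sum1dep_card big_mkcond big_ord_recl [X in _ = _ + X]big_mkcond /=.
rewrite ffunE unlift_none; congr (_ + _).
by apply: eq_bigr => y _; rewrite ffunE liftK.
Qed.

(** Induction on [m] over the label [i] of the first point: the remaining points have fiber sizes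
    [t] lowered by one at [i], so label [i] contributes [t i * m!], and these add up to [m.+1!]. The
    product form avoids dividing during the induction. *)
Lemma card_ffun_fibers (I : finType) m (t : I -> nat) :
    \sum_i t i = m ->
  #|[set r : {ffun 'I_m -> I} | [forall i, #|[set x | r x == i]| == t i]]|
    * \prod_i (t i)`! = m`!.
Proof.
elim: m t => [|m IHm] t sum_t.
  have t0 i : t i = 0.
    by apply/eqP; move/eqP: sum_t; rewrite sum_nat_eq0 => /forallP/(_ i).
  rewrite big1 => [|i _]; last by rewrite t0.
  rewrite muln1 (_ : [set _ | _] = setT) ?cardsT ?card_ffun ?card_ord //.
  apply/setP=> r; rewrite !inE; apply/forallP=> i.
  by rewrite t0 cards_eq0; apply/eqP/setP=> -[].
rewrite -sum1dep_card (reindex _ (onW_bij _ (@cons_ffun_bij I m))) /=.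
rewrite big_mkcond /= -(pair_bigA _ (fun i r =>
  if [forall k, #|[set x | cons_ffun (i, r) x == k]| == t k] then 1 else 0)) /=.
rewrite factS; transitivity ((\sum_i t i) * m`!); last by rewrite sum_t.
rewrite !big_distrl /=; apply: eq_bigr => i _.
rewrite -big_mkcond sum1dep_card.
have [ti0|ti_gt0] := posnP (t i).
  rewrite ti0 mul0n; apply/eqP; rewrite muln_eq0 cards_eq0; apply/orP; left.
  apply/eqP/setP=> r; rewrite !inE; apply/negP=> /forallP/(_ i).
  by rewrite card_fiber_cons_ffun /= eqxx ti0.
pose t' k := t k - (i == k).
have le_t k : (i == k) <= t k by case: eqP => // <-.
have sum_t' : \sum_k t' k = m.
  rewrite sumnB ?sum_t //= (bigD1 i) //= eqxx big1 ?subn1 // => k.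
  by rewrite eq_sym => /negPf->.
rewrite -(IHm t' sum_t') mulnCA; congr (_ * _).
  apply: eq_card => r; rewrite !inE; apply: eq_forallb => k.
  by rewrite card_fiber_cons_ffun /= addnC -[RHS](eqn_add2r (i == k)) subnK.
rewrite (bigD1 i) //= (bigD1 i (P := xpredT)) //= mulnA /t' eqxx.
case: (t i) ti_gt0 => // u _; rewrite factS subn1 /=; congr (_ * _).
by apply: eq_bigr => k; rewrite eq_sym => /negPf->; rewrite subn0.
Qed.

Definition onto_pos k j (r : {ffun 'I_k -> 'I_j.+1}) :=
  [forall i, (i != ord0) ==> [exists x, r x == i]].

Definition fiber_sizes k j (r : {ffun 'I_k -> 'I_j.+1}) : {ffun 'I_j.+1 -> 'I_k.+1} :=
  [ffun i => inord #|[set x | r x == i]|].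

Lemma fiber_sizesE k j (r : {ffun 'I_k -> 'I_j.+1}) i :
  fiber_sizes r i = #|[set x | r x == i]| :> nat.
Proof. by rewrite ffunE inordK // ltnS -[leqRHS]card_ord max_card. Qed.

Lemma fiber_sizes_S_set k j (r : {ffun 'I_k -> 'I_j.+1}) :
  (fiber_sizes r \in S_set k j) = onto_pos r.
Proof.
rewrite inE (eq_bigr _ (fun i _ => fiber_sizesE r i)).
have -> : \sum_i #|[set x | r x == i]| = k.
  rewrite -[RHS]card_ord -sum1_card (partition_big r xpredT) //=.
  by apply: eq_bigr => i _; rewrite -sum1dep_card.
rewrite eqxx; apply: eq_forallb => i; congr (_ ==> _).
rewrite fiber_sizesE card_gt0; apply/set0Pn/existsP => -[x];
  by rewrite ?inE => rx; exists x; rewrite ?inE.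
Qed.

Lemma card_fiber_sizes k j (t : {ffun 'I_j.+1 -> 'I_k.+1}) : t \in S_set k j ->
  #|[set r : {ffun 'I_k -> 'I_j.+1} | onto_pos r && (fiber_sizes r == t)]|
    = multinom k (fun i => t i).
Proof.
move=> tS; have := tS; rewrite inE => /andP[/eqP sum_t _].
rewrite /multinom -(card_ffun_fibers sum_t) mulnK; last first.
  by apply: prodn_gt0 => i; apply: fact_gt0.
apply: eq_card => r; rewrite !inE; apply/andP/forallP => [[_ /eqP<-] i|rt].
  by rewrite fiber_sizesE.
suff rE : fiber_sizes r = t by rewrite -fiber_sizes_S_set rE.
by apply/ffunP=> i; apply: val_inj; rewrite /= fiber_sizesE; apply/eqP.
Qed.

(** A multinomial coefficient counts the labelings with given fiber sizes, so a weighted sum over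
    compositions becomes a plain sum over labelings. The hypothesis on [F] stands in for function
    extensionality. *)
Lemma sum_S_set k j (F : ('I_j.+1 -> nat) -> int) :
  (forall t t', t =1 t' -> F t = F t') ->
  (\sum_(t in S_set k j) (multinom k (fun i => t i))%:Z * F (fun i => t i) =
   \sum_(r : {ffun 'I_k -> 'I_j.+1} | onto_pos r) F (fun i => #|[set x | r x == i]|))%R.
Proof.
move=> eqF; rewrite [RHS](partition_big (@fiber_sizes k j) (mem (S_set k j))) /=; last first.
  by move=> r; rewrite fiber_sizes_S_set.
apply: eq_bigr => t tS.
rewrite (eq_bigr (fun _ => F (fun i => t i))); last first.
  by move=> r /andP[_ /eqP<-]; apply: eqF => i; rewrite fiber_sizesE.
by rewrite sumr_const -[RHS]mulr_natl natz -(card_fiber_sizes tS) cardsE.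
Qed.

(** * Counting by blocks *)

(** Since [Q i] sees only the points labeled [i], choosing [f] amounts to choosing its restriction
    to each block independently. Restrictions are padded with [v0] so that they all have the same
    type; [restr] and [glue] give the correspondence. *)
Lemma card_blocks (T I V : finType) (lab : T -> I) (v0 : V)
    (Q : I -> pred {ffun T -> V}) :
    (forall i (f g : {ffun T -> V}), (forall t, lab t = i -> f t = g t) -> Q i f = Q i g) ->
  #|[set f | [forall i, Q i f]]| =
  \prod_i #|[set f | Q i f && [forall t, (lab t != i) ==> (f t == v0)]]|.
Proof.
move=> locQ.
pose F i := [set f | Q i f && [forall t, (lab t != i) ==> (f t == v0)]].
pose restr (f : {ffun T -> V}) : {ffun I -> {ffun T -> V}} :=
  [ffun i => [ffun t => if lab t == i then f t else v0]].
pose glue (g : {ffun I -> {ffun T -> V}}) : {ffun T -> V} := [ffun t => g (lab t) t].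
have restrK : cancel restr glue by move=> f; apply/ffunP=> t; rewrite !ffunE eqxx.
transitivity #|family F|; last first.
  by rewrite card_family foldrE big_map big_enum.
rewrite -(card_imset _ (can_inj restrK)); apply: eq_card => g.
apply/imsetP/familyP => [[f + -> i] | Fg].
  rewrite !inE => /forallP/(_ i) Qf; rewrite ffunE; apply/andP; split.
    by rewrite -(locQ i f) // => t <-; rewrite ffunE eqxx.
  by apply/forallP=> t; apply/implyP=> /negPf ne; rewrite ffunE ne.
have gE i t : lab t != i -> g i t = v0.
  by have := Fg i; rewrite inE => /andP[_ /forallP/(_ t)/implyP h] /h/eqP.
exists (glue g).
  rewrite inE; apply/forallP=> i; have := Fg i; rewrite inE => /andP[Qg _].
  by rewrite (locQ i _ (g i)) // => t <-; rewrite ffunE.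
apply/ffunP=> i; apply/ffunP=> t; rewrite !ffunE.
by have [->//|/gE] := eqVneq (lab t) i.
Qed.

(** * Fillings of one corner block *)

Section Corner.
Variables (q : nat) (S T : finType) (X : {set S}) (Y : {set T}).
Implicit Types (f : {ffun S * T -> 'I_q.+2}) (D : {set S * T}).

(** This pairwise form is what the absence of a switch yields; it amounts to the non-maximal
    positions lying on one row or one column. With alphabet size [q.+2], the maximal entry is
    [q.+1]. *)
Definition aligned f := [forall p, forall p',
  [&& p.1 != p'.1 & p.2 != p'.2] ==> (f p == ord_max) || (f p' == ord_max)].

Definition positive f := [forall p, f p != ord0].

Definition nonmax f := [set p | f p != ord_max].

(** Outside [D] the value is forced to be [ord_max]; each point of [D] takes any of the [q.+1]
    nonzero values. *)
Lemma card_nonmax_sub D :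
  #|[set f | positive f && (nonmax f \subset D)]| = q.+1 ^ #|D|.
Proof.
transitivity #|pffun_on (ord_max : 'I_q.+2) (mem D) (predC1 ord0)|; last first.
  by rewrite card_pffun_on cardC1 card_ord.
apply: eq_card => f; rewrite inE; apply/andP/pffun_onP => [[/forallP f0 /subsetP fD]|].
  split; first by apply/supportP => p pD; apply/eqP; apply: contraNT pD => ?; rewrite fD ?inE.
  by move=> v /imageP[p _ ->]; rewrite inE.
move=> [/supportP fD f0]; split; last first.
  by apply/subsetP=> p; rewrite inE; apply: contraNT => /fD ->.
apply/forallP=> p; have [pD|pD] := boolP (p \in D); first by apply: f0; apply: image_f.
by rewrite fD.
Qed.

Let ind (b : bool) : int := (b%:R)%R.


(* The right-hand side sorts the aligned sets [D] into: empty, a point, at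
   least two points in a row, at least two points in a column. *)
Lemma aligned_indicator f : nonmax f \subset setX X Y ->
  let D := nonmax f in
  (ind (aligned f) = ind (D == set0) + \sum_(x in X) \sum_(y in Y) ind (D == [set (x, y)])
   + \sum_(x in X) (ind (D \subset setX [set x] Y) - ind (D == set0)
                    - \sum_(y in Y) ind (D == [set (x, y)]))
   + \sum_(y in Y) (ind (D \subset setX X [set y]) - ind (D == set0)
                    - \sum_(x in X) ind (D == [set (x, y)])))%R.
Proof.
move=> sDXY D.
have alignedE : aligned f = [forall p in D, forall p' in D, (p.1 == p'.1) || (p.2 == p'.2)].
  apply: eq_forallb => p; rewrite inE; have [_|_] := eqVneq (f p) ord_max => /=.
    by apply/forallP=> p'; rewrite implybT.
  apply: eq_forallb => p'; rewrite inE.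
  by case: (f p' == _); case: (p.1 == _); case: (p.2 == _).
have [D0|/set0Pn[[x0 y0] D0]] := eqVneq D set0.
  have -> : aligned f by rewrite alignedE; apply/forall_inP => p; rewrite D0 inE.
  have no1 x y : (set0 == [set (x, y)]) = false.
    by apply/negbTE; rewrite eq_sym; apply/set0Pn; exists (x, y); rewrite inE.
  rewrite D0 big1 => [|x _]; last by rewrite big1 // => y _; rewrite no1.
  rewrite big1 => [|x _]; last first.
    by rewrite sub0set subrr big1 ?subr0 // => y _; rewrite no1.
  rewrite big1 => [|y _]; last first.
    by rewrite sub0set subrr big1 ?subr0 // => x _; rewrite no1.
  by rewrite !addr0.
have /setXP[x0X y0Y] := subsetP sDXY _ D0.
have eq1 x y : (x != x0) || (y != y0) -> (D == [set (x, y)]) = false.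
  move=> ne; apply/eqP=> DE; move: D0 ne; rewrite DE inE => /eqP[-> ->].
  by rewrite !eqxx.
(* Once a point (x0, y0) of [D] is fixed, only its row and its column contribute. The right-hand
   side collapses to e + (R - e) + (C - e) with e the indicator of R && C, which is
   inclusion-exclusion for R || C. *)
set R := D \subset setX [set x0] Y; set C := D \subset setX X [set y0].
set e := ind (D == [set (x0, y0)]).
have sumY x : (\sum_(y in Y) ind (D == [set (x, y)]) = if x == x0 then e else 0)%R.
  rewrite (bigD1 y0) //= big1 ?addr0 => [|y /andP[_ ne]]; last by rewrite eq1 // ne orbT.
  by have [->|ne] := eqVneq x x0; last rewrite eq1 // ne.
have sumX y : (\sum_(x in X) ind (D == [set (x, y)]) = if y == y0 then e else 0)%R.
  rewrite (bigD1 x0) //= big1 ?addr0 => [|x /andP[_ ne]]; last by rewrite eq1 // ne.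
  by have [->|ne] := eqVneq y y0; last rewrite eq1 // ne orbT.
have S1 : (\sum_(x in X) \sum_(y in Y) ind (D == [set (x, y)]) = e)%R.
  rewrite (bigD1 x0) //= sumY eqxx big1 ?addr0 // => x /andP[_ /negPf ne].
  by rewrite sumY ne.
have S2 : (\sum_(x in X) (ind (D \subset setX [set x] Y) - ind false
                          - \sum_(y in Y) ind (D == [set (x, y)])) = ind R - e)%R.
  rewrite (bigD1 x0) //= sumY eqxx subr0 big1 ?addr0 // => x /andP[_ /negPf ne].
  rewrite sumY ne !subr0 (_ : D \subset _ = false) //.
  by apply/negbTE/subsetPn; exists (x0, y0) => //; rewrite !inE eq_sym ne.
have S3 : (\sum_(y in Y) (ind (D \subset setX X [set y]) - ind false
                          - \sum_(x in X) ind (D == [set (x, y)])) = ind C - e)%R.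
  rewrite (bigD1 y0) //= sumX eqxx subr0 big1 ?addr0 // => y /andP[_ /negPf ne].
  rewrite sumX ne !subr0 (_ : D \subset _ = false) //.
  by apply/negbTE/subsetPn; exists (x0, y0) => //; rewrite !inE [y0 == y]eq_sym ne andbF.
rewrite S1 S2 S3 /e.
have -> : (D == [set (x0, y0)]) = R && C.
  apply/eqP/andP => [DE|[sR sC]]; first by rewrite /R /C DE !sub1set !inE !eqxx x0X y0Y.
  apply/eqP; rewrite eqEsubset sub1set D0 andbT; apply/subsetP=> -[x y] Dxy.
  have := subsetP sR _ Dxy; have := subsetP sC _ Dxy.
  by rewrite !inE /= => /andP[_ /eqP->] /andP[/eqP-> _].
have -> : aligned f = R || C.
  rewrite alignedE; apply/idP/idP => [al|].
    (* A point of [D] off row x0 must lie in column y0, and one off column y0 must lie in row x0;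
       these two points then share neither row nor column. *)
    apply/norP => -[/subsetPn[[x1 y1] D1 n1] /subsetPn[[x2 y2] D2 n2]].
    have pal p p' : p \in D -> p' \in D -> (p.1 == p'.1) || (p.2 == p'.2).
      by move=> Dp Dp'; have /forall_inP/(_ p' Dp') := forall_inP al p Dp.
    have /setXP[x1X y1Y] := subsetP sDXY _ D1; have /setXP[x2X y2Y] := subsetP sDXY _ D2.
    rewrite !inE /= in x1X y1Y x2X y2Y n1 n2; rewrite y1Y andbT in n1; rewrite x2X /= in n2.
    have := pal _ _ D1 D0; have := pal _ _ D2 D0; have := pal _ _ D1 D2.
    rewrite /= (negPf n1) (negPf n2) orbF => h /eqP x2E /eqP y1E.
    by move: h; rewrite x2E y1E (negPf n1) eq_sym (negPf n2).
  case/orP => [/subsetP sR|/subsetP sC]; apply/forall_inP => p Dp; apply/forall_inP => p' Dp'.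
    by have := sR _ Dp; have := sR _ Dp'; rewrite !inE => /andP[/eqP-> _] /andP[/eqP-> _]; rewrite eqxx.
  by have := sC _ Dp; have := sC _ Dp'; rewrite !inE => /andP[_ /eqP->] /andP[_ /eqP->]; rewrite eqxx orbT.
by case: (R); case: (C).
Qed.

(** Summing [aligned_indicator] over all fillings gives the four terms of [fq]: 1 for the empty set,
    [q] for each single point, and (q+1)^k - kq - 1 for the sets of at least two points in a line of
    k points. *)
Lemma card_corner :
  (#|[set f | [&& positive f, aligned f & nonmax f \subset setX X Y]]|%:Z
   = fq q.+2 #|X| #|Y|)%R.
Proof.
pose W (b : {ffun S * T -> 'I_q.+2} -> bool) : int :=
  (\sum_(f | positive f && (nonmax f \subset setX X Y)) ind (b f))%R.
have Wsub D : D \subset setX X Y ->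
  (W (fun f => nonmax f \subset D) = (q%:Z + 1) ^+ #|D|)%R.
  move=> sD; rewrite /W /ind -natr_sum -big_mkcondr /= sum1dep_card.
  have -> : ((q%:Z + 1) ^+ #|D| = (q.+1 ^ #|D|)%:Z)%R.
    by rewrite -[RHS]natz natrX natz -addn1 PoszD.
  rewrite natz -card_nonmax_sub; congr (Posz _).
  apply: eq_card => f; rewrite !inE -andbA; congr (_ && _).
  by rewrite andb_idl // => /subset_trans; apply.
have W0 : (W (fun f => nonmax f == set0) = 1)%R.
  have := Wsub set0 (sub0set _); rewrite cards0 expr0 => <-; apply: eq_bigr => f _.
  by rewrite subset0.
have W1 x y : x \in X -> y \in Y -> (W (fun f => nonmax f == [set (x, y)]) = q%:Z)%R.
  move=> xX yY.
  have s1 : [set (x, y)] \subset setX X Y by rewrite sub1set inE xX.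
  have := Wsub _ s1; rewrite cards1 expr1 => /(congr1 (fun w => w - 1)%R).
  rewrite addrK => <-; rewrite -W0 -sumrB; apply: eq_bigr => f _.
  rewrite subset1; case: eqVneq => [->|_] /=; last by rewrite subrr.
  rewrite (_ : _ == set0 = false) ?subr0 //.
  by apply/negbTE/set0Pn; exists (x, y); rewrite inE.
transitivity (W aligned).
  rewrite /W /ind -natr_sum -big_mkcondr /= sum1dep_card natz; congr (Posz _).
  by apply: eq_card => f; rewrite !inE andbCA andbC.
rewrite /W (eq_bigr _ (fun f Pf => aligned_indicator (proj2 (andP Pf)))) /=.
have Wsum (I : finType) (P : pred I) (b : I -> {ffun S * T -> 'I_q.+2} -> bool) :
    (\sum_(f | positive f && (nonmax f \subset setX X Y)) \sum_(i | P i) ind (b i f)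
     = \sum_(i | P i) W (b i))%R by rewrite exchange_big.
have WY x : x \in X -> (\sum_(y in Y) W (fun f => nonmax f == [set (x, y)]) = q%:Z *+ #|Y|)%R.
  by move=> xX; rewrite -sumr_const; apply: eq_bigr => y; apply: W1.
have WX y : y \in Y -> (\sum_(x in X) W (fun f => nonmax f == [set (x, y)]) = q%:Z *+ #|X|)%R.
  by move=> yY; rewrite -sumr_const; apply: eq_bigr => x xX; apply: W1.
rewrite !big_split /= -/(W _) W0.
rewrite exchange_big [X in (_ + X + _)%R]exchange_big [X in (_ + _ + X)%R]exchange_big /=.
rewrite (eq_bigr (fun=> q%:Z *+ #|Y|)%R) => [|x xX]; last by rewrite Wsum WY.
rewrite [X in (_ + X + _)%R](eq_bigr (fun=> (q%:Z + 1) ^+ #|Y| - 1 - q%:Z *+ #|Y|)%R); last first.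
  move=> x xX; rewrite !sumrB Wsum WY // -!/(W _) W0 Wsub ?setSX ?setXS ?sub1set //.
  by rewrite cardsX cards1 mul1n.
rewrite [X in (_ + X)%R](eq_bigr (fun=> (q%:Z + 1) ^+ #|X| - 1 - q%:Z *+ #|X|)%R); last first.
  move=> y yY; rewrite !sumrB Wsum WX // -!/(W _) W0 Wsub ?setXS ?sub1set //.
  by rewrite cardsX cards1 muln1.
rewrite !sumr_const /fq -!(addn1 q.+1) -(addn1 q) !PoszD.
have -> : (q%:Z + 1%:Z + 1%:Z - 1 = q%:Z + 1)%R by rewrite addrK.
have -> : (q%:Z + 1%:Z + 1%:Z - 2 = q%:Z)%R by rewrite -addrA addrK.
have mulz (z : int) k : (z *+ k = z * k%:Z)%R by rewrite -mulr_natr natz.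
rewrite !mulz PoszM.
move: ((q%:Z + 1) ^+ #|X|)%R ((q%:Z + 1) ^+ #|Y|)%R (Posz q) (Posz #|X|) (Posz #|Y|).
by move=> *; ring.
Qed.
End Corner.

(** * Staircase structure *)

Lemma in_setId (T : finType) (L : {set T}) (P : pred T) U :
  (U \in [set V in L | P V]) = (U \in L) && P U.
Proof. by rewrite inE. Qed.

Section Structure.
Variables q m n : nat.
Implicit Types A B : 'M['I_q.+2]_(m, n).

Definition switch_free A := forall x x' y y', x != x' -> y != y' ->
  A x y != ord_max -> A x' y' != ord_max -> A x y' != ord0 -> A x' y != ord0 -> False.

(* [r] and [d] are block labels of the rows and columns, label 0 being that of
   the zero rows and columns. *)
Definition staircase A (r : 'I_m -> nat) (d : 'I_n -> nat) :=
  [/\ forall x y, (A x y != ord0) = (0 < r x <= d y),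
      forall x y, 0 < r x < d y -> A x y = ord_max
    & forall x y x' y', x != x' -> y != y' -> 0 < r x ->
        r x = d y -> r x' = d y' -> r x = r x' ->
        (A x y == ord_max) || (A x' y' == ord_max)].

Lemma lt0n_ord (v : 'I_q.+2) : (0 < v) = (v != ord0).
Proof. by rewrite lt0n. Qed.

Lemma ord_max_gt (v : 'I_q.+2) : (v != ord_max) = (v < q.+1).
Proof. by rewrite -val_eqE /= ltn_neqAle -ltnS ltn_ord andbT. Qed.

(** Performing the switch, that is, moving a unit in each of its two rows from the antidiagonal to
    the diagonal, gives a different matrix with the same row and column sums. *)
Lemma lonesum_switch_free A : strong_lonesumb A -> switch_free A.
Proof.
move=> /forallP lA x x' y y' nx ny Axy Axy' Axy'_gt0 Ax'y_gt0.
rewrite !ord_max_gt in Axy Axy'; rewrite -!lt0n_ord in Axy'_gt0 Ax'y_gt0.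
pose up i j := (i == x) * (j == y) + (i == x') * (j == y').
pose down i j := (i == x) * (j == y') + (i == x') * (j == y).
(* These bounds ensure that neither the natural subtraction nor [inord] truncates in [B]; the sums
   are then compared after adding [down] back. *)
have [le_down le_up] : (forall i j, down i j <= A i j) /\
    (forall i j, A i j + up i j <= q.+1 + down i j).
  split=> i j; rewrite /up /down; have leA := leq_ord (A i j);
  have [ix|_] := eqVneq i x; have [jy|_] := eqVneq j y;
  have [ix'|_] := eqVneq i x'; have [jy'|_] := eqVneq j y'; subst; try lia;
  by rewrite ?eqxx in nx ny.
pose B : 'M['I_q.+2]_(m, n) := (\matrix_(i, j) inord (A i j + up i j - down i j)%N)%R.
have BE i j : B i j + down i j = A i j + up i j.
  rewrite mxE inordK; last by have := le_up i j; lia.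
  by rewrite subnK // (leq_trans (le_down i j)) ?leq_addr.
have sum_ind k (z : 'I_k) : \sum_(i < k) (i == z) = 1.
  by rewrite (bigD1 z) //= eqxx big1 // => i /negPf->.
have := lA B; rewrite implybE => /orP[|/eqP BA].
  case/negP; apply/andP; split; apply/forallP => k; apply/eqP.
    apply: (@addIn (\sum_j down k j)); rewrite /row_sums -!big_split /=.
    rewrite (eq_bigr _ (fun j _ => BE k j)) !big_split /=.
    by rewrite /up /down -!big_distrr /= !sum_ind.
  apply: (@addIn (\sum_i down i k)); rewrite /col_sums -!big_split /=.
  rewrite (eq_bigr _ (fun i _ => BE i k)) !big_split /=.
  by rewrite /up /down -!big_distrl /= !sum_ind [X in _ + X]addnC.
have := BE x y; rewrite BA /up /down !eqxx (negPf nx) (negPf ny) /=; lia.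
Qed.

Lemma sum_eq_ltn (I : finType) (f g : I -> nat) i :
  \sum_k f k = \sum_k g k -> f i < g i -> exists k, g k < f k.
Proof.
move=> eq_fg lt_i; apply/existsP; apply: contraT; rewrite negb_exists => /forallP le_fg.
suff : \sum_k f k < \sum_k g k by rewrite eq_fg ltnn.
rewrite (bigD1 i) // [ltnRHS](bigD1 i) //= -addSn leq_add // leq_sum // => k _.
by rewrite leqNgt.
Qed.

(* [A] maximizes the sum of [(d y - r x) * B x y] over all matrices [B] (with a
   very negative weight on zero rows), a quantity that depends only on the row
   and column sums; hence any competitor agrees with [A] off the corner blocks. *)
Lemma staircase_eq_off_corner A B r d x y :
    staircase A r d -> row_sums B =1 row_sums A -> col_sums B =1 col_sums A ->
  ~~ ((0 < r x) && (r x == d y)) -> B x y = A x y.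
Proof.
case=> AE maxA _ eqr eqc off.
(* The [1 +] keeps the weight [u i + d j] strictly negative along a zero row, whatever the
   column. *)
pose u i : int := (if r i == 0 then - (1 + \sum_k (d k)%:Z) else - (r i)%:Z)%R.
pose G i j : int := ((u i + (d j)%:Z) * ((A i j)%:Z - (B i j)%:Z))%R.
have d_le j : ((d j)%:Z <= \sum_k (d k)%:Z)%R.
  by rewrite (bigD1 j) //= lerDl sumr_ge0.
have wG i j : [\/ (0 < u i + (d j)%:Z)%R /\ A i j = ord_max,
    (u i + (d j)%:Z < 0)%R /\ A i j = ord0 | (0 < r i) && (r i == d j)].
  rewrite /u; have := AE i j; have := maxA i j; have := d_le j.
  case: (posnP (r i)) => [->|r0] /= le_d maxij Aij.
    by apply: Or32; split; [lia | apply/eqP; move/negbFE: Aij].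
  case: (ltngtP (r i) (d j)) => cmp.
  - by apply: Or31; split; [lia | exact: maxij].
  - apply: Or32; split; first by lia.
    by apply/eqP; move: Aij; rewrite leqNgt cmp => /negbFE.
  - by apply: Or33.
(* A positive weight meets a maximal entry of [A] and a negative weight a zero entry, so no term is
   negative. Equal margins make the total zero, hence every term vanishes. *)
have G_ge0 i j : (0 <= G i j)%R.
  have leB := leq_ord (B i j).
  rewrite /G; case: (wG i j) => [[w ->]|[w ->]|/andP[r0 /eqP rd]].
  - by rewrite mulr_ge0 ?(ltW w) // subr_ge0 lez_nat.
  - by rewrite mulr_le0 ?(ltW w) // sub0r oppr_le0.
  - by rewrite /u (gtn_eqF r0) rd addNr mul0r.
have sumG : (\sum_i \sum_j G i j = 0)%R.
  have sumZ k (f : 'I_k -> nat) : (\sum_i (f i)%:Z = (\sum_i f i)%N%:Z)%R.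
    by rewrite -[RHS]natz natr_sum; apply: eq_bigr => i _; rewrite natz.
  transitivity (\sum_i u i * ((row_sums A i)%:Z - (row_sums B i)%:Z)
                + \sum_j (d j)%:Z * ((col_sums A j)%:Z - (col_sums B j)%:Z))%R.
    under [X in (_ = _ + X)%R]eq_bigr => j _.
      rewrite /col_sums -!sumZ -sumrB mulr_sumr; over.
    rewrite [X in (_ + X)%R]exchange_big -big_split /=; apply: eq_bigr => i _.
    rewrite /row_sums -!sumZ -sumrB mulr_sumr -big_split; apply: eq_bigr => j _.
    exact: mulrDl.
  by rewrite !big1 ?addr0 // => i _; rewrite ?eqr ?eqc subrr mulr0.
have /eqP : G x y = 0%R.
  have row0 : (\sum_j G x j = 0)%R.
    by apply: (psumr_eq0P _ sumG) => // i _; apply: sumr_ge0.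
  exact: (psumr_eq0P _ row0).
rewrite mulf_eq0 subr_eq0 => /orP[/eqP w0|/eqP[AB]]; last exact/esym/val_inj.
case: (wG x y) => [[]|[]|h]; rewrite ?w0 ?ltxx //.
by rewrite h in off.
Qed.

(** Competitors can differ from [A] only on corner blocks. An excess of [B] at (x, y) forces a
    deficit at some (x, y'), then an excess at some (x', y'). The two excesses are non-maximal
    entries of [A] in one corner block, on different rows and columns, which is excluded. So [B] is
    entrywise at most [A], and equal row sums give equality. *)
Lemma staircase_lonesum A r d : staircase A r d -> strong_lonesumb A.
Proof.
move=> stA; have [AE _ alA] := stA.
apply/forallP => B; apply/implyP => /andP[/forallP rB /forallP cB].
have eqr x : row_sums B x = row_sums A x by apply/eqP.
have eqc y : col_sums B y = col_sums A y by apply/eqP.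
have corner x y : A x y != B x y :> nat -> (0 < r x) && (r x == d y).
  apply: contraR => h; apply/eqP; congr nat_of_ord.
  exact/esym/(staircase_eq_off_corner stA).
have leBA x y : B x y <= A x y.
  rewrite leqNgt; apply/negP => lt1.
  have [y' lt2] := sum_eq_ltn (esym (eqr x)) lt1.
  have [x' lt3] := sum_eq_ltn (eqc y') lt2.
  have /andP[r0 /eqP rd] := corner x y (negbT (ltn_eqF lt1)).
  have /andP[_ /eqP rd2] := corner x y' (negbT (gtn_eqF lt2)).
  have /andP[_ /eqP rd'] := corner x' y' (negbT (ltn_eqF lt3)).
  have nx : x != x' by apply: contraTneq lt3 => <-; rewrite -leqNgt ltnW.
  have ny : y != y' by apply: contraTneq lt2 => <-; rewrite -leqNgt ltnW.
  have lt_max (u v : 'I_q.+2) : u < v -> u != ord_max.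
    by move=> lt_uv; rewrite ord_max_gt -ltnS (leq_trans _ (ltn_ord v)).
  have := alA x y x' y' nx ny r0 rd rd' (etrans rd2 (esym rd')).
  by rewrite (negPf (lt_max _ _ lt1)) (negPf (lt_max _ _ lt3)).
apply/eqP/matrixP => x y; apply/val_inj/eqP; rewrite /= eqn_leq leBA leqNgt.
apply/negP => /(sum_eq_ltn (eqr x))[y']; by rewrite ltnNge leBA.
Qed.

(** * Ranks along the chain of row supports *)

Section Ranks.
Variable A : 'M['I_q.+2]_(m, n).

Definition row_supp x := [set y | A x y != ord0].
Definition levels := [set row_supp x | x : 'I_m] :\ set0.
(** Ranks grow as supports shrink: the largest support has rank 1. The nonemptiness test gives zero
    rows rank 0, the empty set being included in every level. *)
Definition row_rank x :=
  #|[set U in levels | (row_supp x != set0) && (row_supp x \subset U)]|.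
Definition col_rank y := #|[set U in levels | y \in U]|.

Lemma row_supp_levels x : (row_supp x \in levels) = (row_supp x != set0).
Proof. by rewrite !inE imset_f ?andbT. Qed.

Lemma levelsP U : reflect (exists2 x, U = row_supp x & row_supp x != set0) (U \in levels).
Proof.
apply: (iffP idP) => [|[x -> ?]]; last by rewrite row_supp_levels.
by rewrite !inE => /andP[n0 /imsetP[x _ UE]]; exists x; rewrite // -UE.
Qed.

Hypothesis sfA : switch_free A.

(** Two incomparable supports yield a 2 x 2 minor with zeros, hence non-maximal entries, on one
    diagonal and nonzero entries on the other: a switch. *)
Lemma row_supp_chain x x' : (row_supp x \subset row_supp x') || (row_supp x' \subset row_supp x).
Proof.
apply/norP => -[/subsetPn[y xy x'y] /subsetPn[y' x'y' xy']].
move: xy x'y x'y' xy'; rewrite !inE !negbK => xy /eqP x'y x'y' /eqP xy'.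
have ny : y' != y by apply: contraNneq xy => <-; rewrite xy'.
have nx : x != x' by apply: contraNneq xy => ->; rewrite x'y.
by case: (sfA nx ny); rewrite ?xy' ?x'y.
Qed.

Lemma levels_chain U V : U \in levels -> V \in levels -> (U \subset V) || (V \subset U).
Proof. by move=> /levelsP[x -> _] /levelsP[x' -> _]; apply: row_supp_chain. Qed.

Lemma row_rank_gt0 x : (0 < row_rank x) = (row_supp x != set0).
Proof.
rewrite card_gt0; apply/set0Pn/idP => [[U]|ne]; first by rewrite in_setId => /and3P[].
by exists (row_supp x); rewrite in_setId row_supp_levels ne subxx.
Qed.

Lemma row_rankE x : row_supp x != set0 ->
  row_rank x = #|[set U in levels | row_supp x \subset U]|.
Proof. by move=> ne; apply: eq_card => U; rewrite !inE ne. Qed.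

Lemma row_supp_rank x y : (A x y != ord0) = (0 < row_rank x <= col_rank y).
Proof.
apply/idP/andP => [Axy|[]].
  have ne : row_supp x != set0 by apply/set0Pn; exists y; rewrite inE.
  rewrite row_rank_gt0 row_rankE //; split => //; apply/subset_leq_card/subsetP => U.
  by rewrite !in_setId => /andP[-> /subsetP]; apply; rewrite inE.
(* If [y] lies outside the support of [x], every level containing [y] contains that support by the
   chain property, while the support itself is a level missing [y]; the inequality is therefore
   strict. *)
rewrite row_rank_gt0 => ne; apply: contraTT => Axy; rewrite -ltnNge row_rankE //.
apply: proper_card; apply/properP; split.
  apply/subsetP => U; rewrite !in_setId => /andP[UL yU]; rewrite UL /=.
  have := levels_chain UL (etrans (row_supp_levels x) ne); case/orP => // /subsetP/(_ y yU).
  by rewrite inE (negPf Axy).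
by exists (row_supp x); rewrite !in_setId ?row_supp_levels ?ne ?subxx ?inE.
Qed.

Lemma staircase_ranks : staircase A row_rank col_rank.
Proof.
split=> [x y|x y /andP[r0 lt_rd]|x y x' y' nx ny r0 rd rd' rr].
- exact: row_supp_rank.
- have ne : row_supp x != set0 by rewrite -row_rank_gt0.
  have xL : row_supp x \in levels by rewrite row_supp_levels.
  rewrite row_rankE // ltnNge in lt_rd.
  (* A strict inequality of ranks provides a row x' whose support contains y but misses some y' in
     the support of x; were [A x y] not maximal, these rows and columns would form a switch. *)
  have /subsetPn[U] : ~~ ([set U in levels | y \in U] \subset
                          [set U in levels | row_supp x \subset U]).
    by apply: contra lt_rd => /subset_leq_card.
  rewrite !in_setId => /andP[UL yU]; rewrite UL /= => sxU.
  have /levelsP[x' UE _] := UL; rewrite UE inE in yU sxU.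
  have /subsetPn[y' xy' x'y'] := sxU; rewrite !inE in xy' x'y'.
  apply/eqP; apply: contraT => Axy.
  have ny : y != y' by apply: contraNneq x'y' => <-.
  have nx : x != x' by apply: contraNneq x'y' => <-.
  case: (sfA nx ny Axy) => //.
  by move: x'y'; rewrite negbK => /eqP->.
- apply/norP => -[n1 n2]; apply: (sfA nx ny n1 n2).
    by rewrite row_supp_rank r0 rr rd' leqnn.
  by rewrite row_supp_rank -rr r0 rd leqnn.
Qed.

Lemma row_rank_le x : row_rank x <= #|levels|.
Proof. by apply/subset_leq_card/subsetP => U; rewrite in_setId => /andP[]. Qed.

Lemma col_rank_le y : col_rank y <= #|levels|.
Proof. by apply/subset_leq_card/subsetP => U; rewrite in_setId => /andP[]. Qed.

(** On a chain, the number of levels containing a given level is injective; its values lie between 1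
    and the number of levels, so counting makes it surjective. *)
Lemma row_rank_onto i : 0 < i <= #|levels| -> exists x, row_rank x = i.
Proof.
case/andP=> i0 iL.
pose h (U : {set 'I_n}) : 'I_#|levels|.+1 := inord #|[set V in levels | U \subset V]|.
have hE U : h U = #|[set V in levels | U \subset V]| :> nat.
  by rewrite inordK // ltnS; apply/subset_leq_card/subsetP => V; rewrite in_setId => /andP[].
have h_inj : {in levels &, injective h}.
  suff le U V : U \in levels -> V \in levels -> h U = h V -> U \subset V -> U = V.
    move=> U V UL VL hUV; have /orP[] := levels_chain UL VL; first exact: le.
    by move=> sVU; apply/esym/le.
  move=> UL VL hUV sUV; apply/eqP; rewrite eqEsubset sUV /=.
  have /eqP : [set W in levels | V \subset W] = [set W in levels | U \subset W].
    apply/eqP; rewrite eqEcard -!hE hUV leqnn andbT; apply/subsetP => W.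
    by rewrite !in_setId => /andP[-> /(subset_trans sUV)].
  by rewrite eqEsubset => /andP[_ /subsetP/(_ U)]; rewrite !in_setId UL subxx => /(_ isT)/andP[].
have himg : h @: levels = [set~ ord0].
  apply/eqP; rewrite eqEcard card_in_imset // cardsC1 card_ord leqnn andbT.
  apply/subsetP => _ /imsetP[U UL ->]; rewrite !inE -val_eqE /= hE -lt0n card_gt0.
  by apply/set0Pn; exists U; rewrite in_setId UL subxx.
have : inord i \in h @: levels.
  by rewrite himg !inE -val_eqE /= inordK ?ltnS // -lt0n.
case/imsetP => U UL /(congr1 val); rewrite /= hE inordK ?ltnS // => ->.
by have /levelsP[x -> ne] := UL; exists x; rewrite row_rankE.
Qed.

Lemma col_rank_onto i : 0 < i <= #|levels| -> exists y, col_rank y = i.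
Proof.
move=> /[dup] /andP[i0 _] /row_rank_onto[x rx].
have ne : row_supp x != set0 by rewrite -row_rank_gt0 rx.
have xL : row_supp x \in levels by rewrite row_supp_levels.
(* A column in the support of [x] but in no smaller level lies in exactly the levels containing that
   support. It is picked outside the largest level properly inside the support, or arbitrarily if
   there is none. *)
suff [y yx yP] : exists2 y, y \in row_supp x &
    forall U, U \in levels -> U \proper row_supp x -> y \notin U.
  exists y; rewrite -rx row_rankE //; apply: eq_card => U; rewrite !in_setId.
  have [UL|//] := boolP (U \in levels); apply/idP/idP => [yU|/subsetP]; last exact.
  have /orP[sUx|//] := levels_chain UL xL.
  apply: contraTT yU => sxU; apply: yP => //.
  by rewrite properE sUx.
pose P U := (U \in levels) && (U \proper row_supp x).
have [U0 PU0|noP] := pickP P; last first.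
  have /set0Pn[y yx] := ne; exists y => // U UL Ux.
  by have := noP U; rewrite /P UL Ux.
have [U /andP[UL /properP[sUx [y yx yU]]] Umax] := @arg_maxnP _ U0 P (fun U => #|U|) PU0.
exists y => // V VL Vx; apply: contra yU => yV.
have /orP[/subsetP|sUV] := levels_chain VL UL; first exact.
have /eqP -> : U == V by rewrite eqEcard sUV; apply: Umax; rewrite /P VL.
exact: yV.
Qed.

End Ranks.

(** Surjectivity of the labels forces the levels to be the [j] distinct sets [T i], which decrease
    with [i]; counting those that contain a support or a column recovers [r] and [d]. The support of
    a row labeled [i.+1] is [T i]. *)
Lemma staircase_ranks_unique A j r d :
    staircase A r d -> (forall x, r x <= j) -> (forall y, d y <= j) ->
    (forall i, 0 < i <= j -> exists x, r x = i) ->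
    (forall i, 0 < i <= j -> exists y, d y = i) ->
  [/\ #|levels A| = j, row_rank A =1 r & col_rank A =1 d].
Proof.
case=> AE _ _ r_le d_le r_onto d_onto.
pose T (i : 'I_j) := [set y | i < d y].
have T_sub (i k : 'I_j) : (T i \subset T k) = (k <= i).
  apply/subsetP/idP => [Tik|le_ki y]; last by rewrite !inE; apply: leq_trans.
  have [|y dy] := d_onto i.+1; first by rewrite ltn_ord.
  by have := Tik y; rewrite !inE dy ltnS leqnn => /(_ isT).
have T_inj : injective T.
  move=> i k /eqP; rewrite eqEsubset !T_sub => ik.
  by apply/val_inj/eqP; rewrite /= eqn_leq andbC.
have suppE x (r0 : 0 < r x) : row_supp A x = [set y | r x <= d y].
  by apply/setP=> y; rewrite !inE AE r0.
have suppT x i : r x = i.+1 -> row_supp A x = [set y | i < d y].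
  by move=> rx; rewrite suppE rx.
have supp0 x : (row_supp A x == set0) = (r x == 0).
  have [r0|r0] := posnP (r x).
    by apply/eqP/setP => y; rewrite !inE AE r0.
  apply/negbTE/set0Pn.
  have [|y dy] := d_onto (r x); first by rewrite r0 r_le.
  by exists y; rewrite inE AE dy r0 leqnn.
have levE : levels A = [set T i | i : 'I_j].
  apply/setP => U; apply/levelsP/imsetP => [[x ->]|[i _ ->]].
    rewrite supp0 -lt0n; case rx: (r x) => [//|i] _.
    have lt_ij : i < j by rewrite -rx r_le.
    by exists (Ordinal lt_ij); rewrite // (suppT _ _ rx).
  have [|x rx] := r_onto i.+1; first by rewrite ltn_ord.
  by exists x; rewrite ?supp0 ?rx ?(suppT _ _ rx).
have card_lt k : k <= j -> #|[set i : 'I_j | i < k]| = k.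
  by move=> le_kj; rewrite -sum1dep_card -(big_ord_widen _ (fun=> 1) le_kj) sum1_card card_ord.
have card_lev (P : pred {set 'I_n}) k : k <= j -> (forall i, P (T i) = (i < k)) ->
    #|[set U in levels A | P U]| = k.
  move=> le_kj PT; rewrite -[RHS](card_lt k le_kj) -(card_imset _ T_inj).
  apply: eq_card => U; rewrite in_setId levE; apply/andP/imsetP => [[/imsetP[i _ ->]]|[i]].
    by rewrite PT => lt_ik; exists i; rewrite ?inE.
  by rewrite inE -PT => Pi ->; rewrite imset_f.
split=> [|x|y].
- by rewrite levE card_imset // card_ord.
- rewrite /row_rank supp0; apply: card_lev => // i.
  case rx: (r x) => [//|k]; rewrite (suppT _ _ rx) /=.
  have lt_kj : k < j by rewrite -rx r_le.
  by rewrite -[[set y | k < d y]]/(T (Ordinal lt_kj)) T_sub ltnS.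
- by apply: card_lev => // i; rewrite inE.
Qed.

End Structure.

(** * Counting staircases *)

Section Count.
Variables q m n : nat.

(** * Independent filling of the blocks for fixed labels *)

Section Blocks.
Variables (j : nat) (r : {ffun 'I_m -> 'I_j.+1}) (d : {ffun 'I_n -> 'I_j.+1}).
Implicit Types (p : 'I_m * 'I_n) (f g : {ffun 'I_m * 'I_n -> 'I_q.+2}).

(** All positions outside the corner blocks are pooled under label 0, where the labels of row and
    column force the entry. *)
Definition block_label p := if r p.1 == d p.2 then r p.1 else ord0.

Definition block i f :=
  if i == ord0 then
    [forall p, (block_label p == ord0) ==>
       (f p == if 0 < r p.1 < d p.2 then ord_max else ord0)]
  else [forall p, (block_label p == i) ==> (f p != ord0)] &&
       [forall p, forall p', [&& block_label p == i, block_label p' == i,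
                                 p.1 != p'.1 & p.2 != p'.2] ==>
          (f p == ord_max) || (f p' == ord_max)].

Lemma block_label_pos p i : i != ord0 ->
  (block_label p == i) = (r p.1 == i) && (d p.2 == i).
Proof.
rewrite /block_label => /negPf i0; have [->|ne] := eqVneq (r p.1) (d p.2).
  by rewrite andbb.
rewrite eq_sym i0; apply/esym/negbTE/andP => -[/eqP re /eqP de].
by rewrite re de eqxx in ne.
Qed.

Lemma block_local i f g :
  (forall p, block_label p = i -> f p = g p) -> block i f = block i g.
Proof.
move=> fg; rewrite /block; case: ifP => [/eqP i0|_].
  by apply: eq_forallb => p; case: eqP => //= lp; rewrite fg // i0.
congr (_ && _); apply: eq_forallb => p; first by case: eqP => //= lp; rewrite fg.
apply: eq_forallb => p'; case: (block_label p =P i) => //= lp.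
by case: (block_label p' =P i) => //= lp'; rewrite !fg.
Qed.

Lemma staircaseP (A : 'M['I_q.+2]_(m, n)) :
  reflect (staircase A (fun x => r x) (fun y => d y))
          [forall i, block i [ffun p => A p.1 p.2]].
Proof.
apply: (iffP forallP) => [blk | [AE maxA alA] i].
  have pos x y : r x = d y -> r x != ord0 -> A x y != ord0.
    move=> rd r0; have := blk (r x); rewrite /block (negPf r0) => /andP[/forallP/(_ (x, y)) + _].
    by rewrite block_label_pos //= -rd eqxx ffunE.
  have off x y : ~~ ((r x == d y) && (r x != ord0)) ->
      A x y = if 0 < r x < d y then ord_max else ord0.
    move=> ne; have := blk ord0; rewrite /block eqxx => /forallP/(_ (x, y)).
    have -> : block_label (x, y) == ord0.
      by move: ne; rewrite /block_label /=; case: eqP => //=; rewrite negbK.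
    by rewrite ffunE /= => /eqP.
  split=> [x y|x y lt_rd|x y x' y' nx ny r0 rd rd' rr].
  - have [/andP[/eqP rd r0]|ne] := boolP ((r x == d y) && (r x != ord0)).
      by rewrite pos // -rd leqnn andbT lt0n.
    rewrite off //; case: (ltngtP (r x) (d y)) => [lt|gt|eq].
    + by rewrite andbT; case: posnP.
    + by rewrite andbF.
    + rewrite (val_inj eq) eqxx /= negbK in ne.
      have r0 : r x = ord0 by rewrite (val_inj eq) (eqP ne).
      by rewrite r0.
  - rewrite off ?lt_rd //; apply/nandP; left.
    by case/andP: lt_rd => _; apply: contraL => /eqP->; rewrite ltnn.
  have r0' : r x != ord0 by rewrite -val_eqE /= -lt0n.
  have := blk (r x); rewrite /block (negPf r0') => /andP[_ /forallP/(_ (x, y))/forallP/(_ (x', y'))].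
  rewrite !block_label_pos //= -(val_inj rd) -(val_inj rd') -(val_inj rr) !eqxx nx ny.
  by rewrite !ffunE.
rewrite /block; case: ifP => [_|/negbT i0].
  apply/forallP => -[x y]; apply/implyP; rewrite ffunE /block_label /=.
  move=> lab0; case: ifP => [lt|nlt]; first by rewrite maxA.
  rewrite -[_ == _]negbK AE; move: nlt lab0.
  case: (ltngtP (r x) (d y)) => [_|_|eq]; rewrite ?andbF // ?andbT.
    by move=> ->.
  by rewrite (val_inj eq) eqxx => _ /eqP ->.
have i_gt0 : 0 < i by rewrite lt0n.
apply/andP; split.
  apply/forallP => p; rewrite block_label_pos //; apply/implyP => /andP[/eqP re /eqP de].
  by rewrite ffunE AE re de leqnn i_gt0.
apply/forallP => p; apply/forallP => p'; apply/implyP; rewrite !block_label_pos //.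
case/and4P => /andP[/eqP re /eqP de] /andP[/eqP re' /eqP de'] nx ny.
by rewrite !ffunE; apply: alA; rewrite ?re ?re' ?de ?de'.
Qed.

Lemma card_staircase :
  (#|[set A : 'M['I_q.+2]_(m, n) | [forall i, block i [ffun p => A p.1 p.2]]]|%:Z
   = \prod_(i < j.+1 | i != ord0)
       fq q.+2 #|[set x | r x == i]| #|[set y | d y == i]|)%R.
Proof.
pose toM f : 'M['I_q.+2]_(m, n) := (\matrix_(x, y) f (x, y))%R.
have toMK : cancel toM (fun A => [ffun p => A p.1 p.2]).
  by move=> f; apply/ffunP => -[x y]; rewrite ffunE mxE.
have -> : [set A : 'M['I_q.+2]_(m, n) | [forall i, block i [ffun p => A p.1 p.2]]]
    = toM @: [set f | [forall i, block i f]].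
  apply/setP => A; rewrite inE; apply/idP/imsetP => [blk|[f + ->]]; last by rewrite inE toMK.
  by exists [ffun p => A p.1 p.2]; rewrite ?inE //; apply/matrixP => x y; rewrite mxE ffunE.
rewrite card_imset; last exact: can_inj toMK.
(* Padding with [ord_max] turns the condition off block [i] into [nonmax f] lying in the product of
   the two fibers, as in [card_corner]. Block 0 has a single filling and contributes 1. *)
rewrite (card_blocks ord_max block_local) (bigD1 ord0) //=.
rewrite [X in X * _](_ : _ = 1) ?mul1n; last first.
  apply/eqP/cards1P; exists [ffun p => if block_label p == ord0 then
    (if 0 < r p.1 < d p.2 then ord_max else ord0) else ord_max].
  apply/setP => f; rewrite !inE /block eqxx; apply/andP/eqP => [[/forallP f0 /forallP f1]|->].
    apply/ffunP => p; rewrite ffunE; case: ifP => lp.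
      by have := f0 p; rewrite lp => /eqP.
    by have := f1 p; rewrite lp => /eqP.
  by split; apply/forallP => p; rewrite ffunE; case: (block_label p == _) => /=.
rewrite -[LHS]natz natr_prod; apply: eq_bigr => i i0.
rewrite natz -card_corner; congr (Posz _); apply: eq_card => f; rewrite !inE.
rewrite /block (negPf i0).
have inXY p : (p \in setX [set x | r x == i] [set y | d y == i]) = (block_label p == i).
  by rewrite block_label_pos // !inE.
have -> : (nonmax f \subset setX [set x | r x == i] [set y | d y == i])
    = [forall p, (block_label p != i) ==> (f p == ord_max)].
  apply/subsetP/forallP => [sub p|sub p].
    by rewrite -inXY; apply/implyP; apply: contraR => ne; rewrite sub ?inE.
  by have := sub p; rewrite [p \in nonmax f]inE inXY; case: (block_label p == i) => //= ->.
rewrite andbA; apply: andb_id2r => /forallP outside.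
congr (_ && _).
  apply: eq_forallb => p; have := outside p.
  by case: (block_label p == i) => //= /eqP ->.
apply: eq_forallb => p; apply: eq_forallb => p'; have := outside p; have := outside p'.
case: (block_label p == i) => /= [|_ /eqP ->]; last by rewrite eqxx implybT.
by case: (block_label p' == i) => //= /eqP -> _; rewrite eqxx orbT implybT.
Qed.
End Blocks.

(** * Sorting strong lonesum matrices by their labels *)

Lemma onto_leq k j (g : 'I_k -> nat) :
  (forall i, 0 < i <= j -> exists x, g x = i) -> j <= k.
Proof.
move=> onto; rewrite -[leqLHS](size_iota 1) -[leqRHS]card_ord -(size_image g).
apply: uniq_leq_size; first exact: iota_uniq.
by move=> i; rewrite mem_iota ltnS => /onto[x <-]; apply: image_f.
Qed.

Lemma onto_posP k j (g : {ffun 'I_k -> 'I_j.+1}) :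
  reflect (forall i, 0 < i <= j -> exists x, g x = i :> nat) (onto_pos g).
Proof.
apply: (iffP forallP) => [onto i /andP[i0 le_ij]|onto i].
  have := onto (inord i); rewrite -val_eqE /= inordK // -lt0n i0 => /existsP[x /eqP gx].
  by exists x; rewrite gx inordK.
apply/implyP; rewrite -val_eqE /= -lt0n => i0.
have [|x gx] := onto i; first by rewrite i0 -ltnS ltn_ord.
by apply/existsP; exists x; apply/eqP/val_inj.
Qed.

Definition rank_pair j (A : 'M['I_q.+2]_(m, n)) :
    {ffun 'I_m -> 'I_j.+1} * {ffun 'I_n -> 'I_j.+1} :=
  ([ffun x => inord (row_rank A x)], [ffun y => inord (col_rank A y)]).

(** The matrices are sorted by their pair of rank labelings; by [staircase_ranks] and
    [staircase_ranks_unique], those with labels [r] and [d] are exactly the staircase matrices for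
    them. *)
Lemma card_lonesum_levels j :
  (#|[set A : 'M['I_q.+2]_(m, n) | strong_lonesumb A && (#|levels A| == j)]|%:Z
   = \sum_(r : {ffun 'I_m -> 'I_j.+1} | onto_pos r)
     \sum_(d : {ffun 'I_n -> 'I_j.+1} | onto_pos d)
       \prod_(i < j.+1 | i != ord0)
         fq q.+2 #|[set x | r x == i]| #|[set y | d y == i]|)%R.
Proof.
rewrite -sum1dep_card (partition_big (@rank_pair j)
  (fun p => onto_pos p.1 && onto_pos p.2)) /=; last first.
  move=> A /andP[/lonesum_switch_free sfA /eqP levA]; apply/andP; split; apply/onto_posP => i.
    rewrite -{1}levA => /(row_rank_onto sfA)[x rx]; exists x.
    by rewrite ffunE inordK // ltnS -levA row_rank_le.
  rewrite -{1}levA => /(col_rank_onto sfA)[y dy]; exists y.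
  by rewrite ffunE inordK // ltnS -levA col_rank_le.
rewrite pair_big -[LHS]natz natr_sum.
apply: eq_bigr => -[r d] /= /andP[/onto_posP r_onto /onto_posP d_onto].
rewrite -card_staircase natz sum1dep_card; congr (Posz _); apply: eq_card => A.
rewrite !inE; apply/andP/staircaseP => [[/andP[/lonesum_switch_free sfA /eqP levA] /eqP[rE dE]]|stA].
  have [AE maxA alA] := staircase_ranks sfA.
  have rx x : r x = row_rank A x :> nat.
    by rewrite -rE ffunE inordK // ltnS -levA row_rank_le.
  have dy y : d y = col_rank A y :> nat.
    by rewrite -dE ffunE inordK // ltnS -levA col_rank_le.
  split=> [x y|x y|x y x' y'].
  - by rewrite rx dy.
  - by rewrite rx dy; apply: maxA.
  - by rewrite !rx !dy; apply: alA.
have le_r x : r x <= j by rewrite -ltnS.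
have le_d y : d y <= j by rewrite -ltnS.
have [levA rE dE] := staircase_ranks_unique stA le_r le_d r_onto d_onto.
rewrite (staircase_lonesum stA) levA eqxx; split=> //.
apply/eqP; congr (_, _); apply/ffunP => z; rewrite ffunE ?rE ?dE; exact: inord_val.
Qed.

Lemma card_lonesum :
  ((num_strong_lonesum q.+2 m n)%:Z
   = \sum_(0 <= j < (minn m n).+1)
     \sum_(r : {ffun 'I_m -> 'I_j.+1} | onto_pos r)
     \sum_(d : {ffun 'I_n -> 'I_j.+1} | onto_pos d)
       \prod_(i < j.+1 | i != ord0)
         fq q.+2 #|[set x | r x == i]| #|[set y | d y == i]|)%R.
Proof.
have lev_le (A : 'M['I_q.+2]_(m, n)) : strong_lonesumb A -> #|levels A| <= minn m n.
  move=> /lonesum_switch_free sfA; rewrite leq_min.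
  by rewrite (onto_leq (row_rank_onto sfA)) (onto_leq (col_rank_onto sfA)).
under eq_bigr do rewrite -card_lonesum_levels.
rewrite big_mkord /num_strong_lonesum -sum1dep_card.
rewrite (partition_big (fun A : 'M['I_q.+2]_(m, n) => inord #|levels A| : 'I_(minn m n).+1) xpredT) //=.
rewrite -[LHS]natz natr_sum; apply: eq_bigr => j _; rewrite natz sum1dep_card.
congr (Posz _); apply: eq_card => A; rewrite !inE; apply: andb_id2l => lA.
by rewrite -val_eqE /= inordK // ltnS lev_le.
Qed.
End Count.

(** Negation in Z/(j+1) fixes 0 and sends a nonzero label i to j + 1 - i, the index reversal in the
    product of the theorem. *)
Definition opp_ffun k j (g : {ffun 'I_k -> 'I_j.+1}) : {ffun 'I_k -> 'I_j.+1} :=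
  [ffun x => (- g x)%R].

Lemma opp_ffunK k j : involutive (@opp_ffun k j).
Proof. by move=> g; apply/ffunP => x; rewrite !ffunE opprK. Qed.

Lemma onto_pos_opp k j (g : {ffun 'I_k -> 'I_j.+1}) : onto_pos (opp_ffun g) = onto_pos g.
Proof.
suff sub h : onto_pos h -> onto_pos (@opp_ffun k j h).
  by apply/idP/idP => /sub //; rewrite opp_ffunK.
move=> /forallP onto; apply/forallP => i; apply/implyP => i0.
have := onto (- i)%R; rewrite oppr_eq0 i0 => /existsP[x /eqP hx].
by apply/existsP; exists x; rewrite ffunE hx opprK.
Qed.

Lemma inord_subn j (i : 'I_j.+1) : i != ord0 -> inord (j.+1 - i) = (- i)%R.
Proof.
rewrite -val_eqE /= -lt0n => i0; apply: val_inj; rewrite /= inordK; last by lia.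
by rewrite modn_small; last by lia.
Qed.

Local Open Scope ring_scope.

Theorem theorem3p6 (q m n : nat) (hq : (2 <= q)%N) (hm : (1 <= m)%N) (hn : (1 <= n)%N) :
  (num_strong_lonesum q m n)%:Z =
  1 + \sum_(1 <= j < (minn m n).+1)
        \sum_(mt in S_set m j) \sum_(nt in S_set n j)
          ((multinom m (fun i => nat_of_ord (mt i))
            * multinom n (fun i => nat_of_ord (nt i)))%N%:Z
           * \prod_(i < j.+1 | i != ord0)
               fq q (mt i) (nt (inord (j.+1 - i)))).
Proof.
case: q hq => [|[|q]] // _; rewrite card_lonesum big_ltn //; congr (_ + _).
  (* For [j = 0] there is one labeling of the rows, one of the columns, and an empty product. *)
  rewrite (eq_bigr (fun=> 1)) => [|r _]; last first.
    rewrite (eq_bigr (fun=> 1)) => [|d _]; last by rewrite big1 // => i; rewrite ord1.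
    rewrite sumr_const (eq_card (B := predT)) ?card_ffun ?card_ord ?exp1n // => d.
    by apply/forallP => i; rewrite ord1.
  rewrite sumr_const (eq_card (B := predT)) ?card_ffun ?card_ord ?exp1n // => r.
  by apply/forallP => i; rewrite ord1.
apply: eq_bigr => j _.
transitivity (\sum_(mt in S_set m j) (multinom m (fun i => mt i))%:Z *
  \sum_(nt in S_set n j) (multinom n (fun i => nt i))%:Z *
    \prod_(i < j.+1 | i != ord0) fq q.+2 (mt i) (nt (inord (j.+1 - i)))); last first.
  by apply: eq_bigr => mt _; rewrite mulr_sumr; apply: eq_bigr => nt _; rewrite PoszM mulrA.
rewrite (sum_S_set m (F := fun t => \sum_(nt in S_set n j) (multinom n (fun i => nt i))%:Z *
    \prod_(i < j.+1 | i != ord0) fq q.+2 (t i) (nt (inord (j.+1 - i))))); last first.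
  by move=> t t' tt'; apply: eq_bigr => nt _; congr (_ * _); apply: eq_bigr => i _; rewrite tt'.
apply: eq_bigr => r _.
rewrite (sum_S_set n (F := fun t =>
    \prod_(i < j.+1 | i != ord0) fq q.+2 #|[set x | r x == i]| (t (inord (j.+1 - i))))); last first.
  by move=> t t' tt'; apply: eq_bigr => i _; rewrite tt'.
(* After negating the column labels, the fiber over j + 1 - i becomes the fiber over i. *)
rewrite (reindex_inj (inv_inj (@opp_ffunK n j))) /=.
apply: eq_big => [d|d _]; first exact: onto_pos_opp.
apply: eq_bigr => i i0; rewrite inord_subn //; congr fq; apply: eq_card => y.
by rewrite !inE ffunE eqr_oppLR.
Qed.
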